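(* (i) For $1\le m\le N$, the pdf $p_{[\mathbf Z_m]}$ on $\mathbb M_{\nu,m}$ given by $$p_{[\mathbf Z_m]}([z])=c_{\nu m}\prod_{\ell=1}^N\Big\{\sum_{j=1}^N\exp\Big\{-\frac1{2\widehat s^2}\Big\|\frac{\widehat s}{s}\eta_d^j-\sum_{\alpha=1}^mz^\alpha g_\ell^\alpha\Big\|^2\Big\}\Big\}$$ (where $[z]=[z^1\cdots z^m]$ with $z^\alpha\in\mathbb R^\nu$, and $c_{\nu m}>0$ is the normalization constant) can be rewritten, for all $[z]\in\mathbb M_{\nu,m}$, as $$p_{[\mathbf Z_m]}([z])=\sum_{\mathbf j\in\mathcal J}p_{\mathbf j}(m)\prod_{k=1}^\nu p_{\widehat{\mathbf Z}^k}(\widehat z^k;\mathbf j),\qquad \widehat z^k=(\widehat z^k_1,\dots,\widehat z^k_m)\in\mathbb R^m,\quad \widehat z^k_\alpha=[z]_{k\alpha},$$ in which, for all $\mathbf j\in\mathcal J$, $$p_{\mathbf j}(m)=\gamma_{\mathbf j}(m)\Big(\sum_{\mathbf j'\in\mathcal J}\gamma_{\mathbf j'}(m)\Big)^{-1},\quad \sum_{\mathbf j\in\mathcal J}p_{\mathbf j}(m)=1,\quad \gamma_{\mathbf j}(m)=\exp\Big\{-\frac1{2s^2}\langle[I_N]-[G_m],[M_d(\mathbf j)]\rangle_F\Big\},$$ with $[M_d(\mathbf j)]=[\eta_d(\mathbf j)]^T[\eta_d(\mathbf j)]$ a positive (semidefinite) symmetric $N\times N$ matrix, $[M_d(\mathbf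 j)]_{\ell\ell'}=\langle\eta_d^{j_\ell},\eta_d^{j_{\ell'}}\rangle$. For all $k\in\{1,\dots,\nu\}$, $p_{\widehat{\mathbf Z}^k}(\cdot;\mathbf j)$ is the Gaussian pdf such that, for all $\widehat z^k\in\mathbb R^m$, $$p_{\widehat{\mathbf Z}^k}(\widehat z^k;\mathbf j)=((2\pi)^m\det[C_m])^{-1/2}\exp\Big\{-\frac12\big\langle[C_m]^{-1}(\widehat z^k-\underline{\widehat z}^k(\mathbf j)),\widehat z^k-\underline{\widehat z}^k(\mathbf j)\big\rangle\Big\},$$ where $[C_m]=\widehat s^2([g_m]^T[g_m])^{-1}$ is a positive-definite symmetric $m\times m$ matrix, $\underline{\widehat z}^k(\mathbf j)=(\widehat s/s)[a_m]^T\widehat\eta_d^k(\mathbf j)\in\mathbb R^m$, and $\widehat\eta_d^k(\mathbf j)\in\mathbb R^N$ has components $\widehat\eta_{d,\ell}^k(\mathbf j)=[\eta_d(\mathbf j)]_{k\ell}$, $\ell=1,\dots,N$. (ii) For all $\mathbf j\in\mathcal J$ and all $1\le m\le N-1$, setting $a_{\mathbf j}(m)=\langle[I_N]-[G_m],[M_d(\mathbf j)]\rangle_F$, one has $a_{\mathbf j}(m)\ge0$, $0<\gamma_{\mathbf j}(m)<1$ and $0<p_{\mathbf j}(m)<1$; and for $m=N$, $a_{\mathbf j}(N)=0$, $\gamma_{\mathbf j}(N)=1$ and $p_{\mathbf j}(N)=1/N^N$.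
   Context: $\mathbb M_{n,m}$ is the set of real $n\times m$ matrices; $\|\cdot\|$ is the Euclidean norm, $\langle\cdot,\cdot\rangle$ the Euclidean inner product, $\langle[x],[y]\rangle_F=\mathrm{Tr}([x]^T[y])$; $[I_n]$ is the $n\times n$ identity matrix. Data: $1\le\nu<N$ are integers, $\eta_d^1,\dots,\eta_d^N\in\mathbb R^\nu$ are given points, $[\eta_d]=[\eta_d^1\cdots\eta_d^N]\in\mathbb M_{\nu,N}$, with $\sum_j\eta_d^j=0$ and $\frac1{N-1}[\eta_d][\eta_d]^T=[I_\nu]$. Set $s=\big(\frac4{N(\nu+2)}\big)^{1/(\nu+4)}$ and $\widehat s=s\big(s^2+\frac{N-1}N\big)^{-1/2}$. Diffusion-maps basis: for fixed $\varepsilon_{DM}>0$, $[K]_{ij}=\exp\{-(4\varepsilon_{DM})^{-1}\|\eta_d^i-\eta_d^j\|^2\}$ is assumed positive definite, $[b]$ is diagonal with $[b]_{ii}=\sum_j[K]_{ij}$, $[\mathbb P]=[b]^{-1}[K]$. Its eigenvalues $1=\lambda_1>\lambda_2\ge\dots\ge\lambda_N$ and right eigenvectors $\psi^\alpha$ are normalized by $\langle[b]\psi^\alpha,\psi^\beta\rangle=\delta_{\alpha\beta}$; $\psi^1$ is a constant vector. For a fixed integer $\kappa\ge0$, $g^\alpha=\lambda_\alpha^\kappa\psi^\alpha=(g_1^\alpha,\dots,g_N^\alpha)$, $[g_m]=[g^1\cdots g^m]\in\mathbb M_{N,m}$, $[a_m]=[g_m]([g_m]^T[g_m])^{-1}\in\mathbb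 M_{N,m}$ and $[G_m]=[a_m][g_m]^T\in\mathbb M_{N,N}$. $\mathcal J=\{1,\dots,N\}^N$, and for $\mathbf j=(j_1,\dots,j_N)\in\mathcal J$, $[\eta_d(\mathbf j)]=[\eta_d^{j_1}\cdots\eta_d^{j_N}]\in\mathbb M_{\nu,N}$.
   Formalization: In (ii), the bound γ_j(m)<1 for m≤N−1 is false for constant multi-indices j (there a_j(m)=0 and γ_j(m)=1); it is replaced by γ_j(m)≤1, with γ_j(m)<1 exactly when a_j(m)>0. *)

(* Defs.v *)
From mathcomp Require Import all_boot all_order all_algebra.
From mathcomp Require Import all_classical all_reals all_analysis.

Set Implicit Arguments.
Unset Strict Implicit.
Unset Printing Implicit Defensive.

Import Order.TTheory GRing.Theory Num.Theory.

Local Open Scope ring_scope.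

(* Indices are 0-based throughout. *)

Section Euclidean.
Context {R : realType}.

Definition dot (n : nat) (x y : 'cV[R]_n) : R := (x^T *m y) 0 0.

(* MathComp-Analysis equips matrices with the sup norm [`|x|]; this is the
   Euclidean one. *)
Definition enorm (n : nat) (x : 'cV[R]_n) : R := Num.sqrt (dot x x).

Definition frob (n m : nat) (A B : 'M[R]_(n, m)) : R := \tr (A^T *m B).

Definition posdef (n : nat) (A : 'M[R]_n) : Prop :=
  A^T = A /\ forall x : 'cV[R]_n, x != 0 -> 0 < dot (A *m x) x.

Definition possemidef (n : nat) (A : 'M[R]_n) : Prop :=
  A^T = A /\ forall x : 'cV[R]_n, 0 <= dot (A *m x) x.

End Euclidean.

Section Density.
Context {R : realType}.

(* The library has no Lebesgue measure on R^n.  For the nonnegative continuous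
   functions considered here, the integral against it is the iterated
   one-dimensional Lebesgue integral, by Tonelli. *)
Fixpoint integral_rV (n : nat) : ('rV[R]_n -> \bar R) -> \bar R :=
  match n with
  | 0 => fun f => f 0
  | n'.+1 => fun f =>
      (\int[@lebesgue_measure R]_x
         integral_rV (fun v : 'rV[R]_n' =>
           f (row_mx (x : R)%:M v : 'rV[R]_(1 + n'))))%E
  end.

Definition integral_mx (n m : nat) (f : 'M[R]_(n, m) -> R) : \bar R :=
  integral_rV (fun v : 'rV[R]_(n * m) => (f (vec_mx v))%:E).

(* Density with respect to the Lebesgue measure of the n * m entries; vectors
   of R^m are the case 'M_(m, 1). *)
Definition is_pdf (n m : nat) (p : 'M[R]_(n, m) -> R) : Prop :=
  (forall z, 0 <= p z) /\ integral_mx p = 1%E.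

Definition gaussian_pdf (m : nat) (C : 'M[R]_m) (mu z : 'cV[R]_m) : R :=
  ((2 * pi) ^+ m * \det C) `^ (- 2^-1)
  * expR (- 2^-1 * dot (invmx C *m (z - mu)) (z - mu)).

End Density.

Section Bandwidth.
Context {R : realType}.
Variables (nu N : nat).

Definition bw : R := (4 / (N%:R * (nu%:R + 2))) `^ (nu%:R + 4)^-1.

Definition bw_hat : R :=
  bw * (bw ^+ 2 + (N%:R - 1) / N%:R) `^ (- 2^-1).

End Bandwidth.

Section DiffusionMaps.
Context {R : realType}.
Variables (nu N : nat) (eta : 'M[R]_(nu, N)) (eps : R).

Definition dm_kernel : 'M[R]_N :=
  \matrix_(i, j)
    expR (- (4 * eps)^-1 * enorm (col i eta - col j eta) ^+ 2).

Definition dm_b : 'M[R]_N := diag_mx (\row_i \sum_j dm_kernel i j).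

Definition dm_transition : 'M[R]_N := invmx dm_b *m dm_kernel.

(* [lambda a] and [col a Psi] are lambda_(a+1) and psi^(a+1). *)
Definition dm_basis (lambda : 'I_N -> R) (Psi : 'M[R]_N) : Prop :=
  [/\ (forall a : 'I_N, a = 0 :> nat -> lambda a = 1),
      (forall a : 'I_N, (0 < a)%N -> lambda a < 1) &
      (forall a b : 'I_N, (a <= b)%N -> lambda b <= lambda a)] /\
  [/\ (forall a : 'I_N,
         dm_transition *m col a Psi = lambda a *: col a Psi),
      (forall a b : 'I_N,
         dot (dm_b *m col a Psi) (col b Psi) = (a == b)%:R) &
      (forall a : 'I_N, a = 0 :> nat ->
         forall l l' : 'I_N, Psi l a = Psi l' a)].

End DiffusionMaps.

Section Reduced.
Context {R : realType}.
Variables (N : nat) (lambda : 'I_N -> R) (Psi : 'M[R]_N) (kappa : nat).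
Variables (m : nat) (hm : (m <= N)%N).

Definition gmat : 'M[R]_(N, m) :=
  \matrix_(l, a) (lambda (widen_ord hm a) ^+ kappa * Psi l (widen_ord hm a)).

End Reduced.

Section Mixture.
Context {R : realType}.
Variables (nu N m : nat) (eta : 'M[R]_(nu, N)) (g : 'M[R]_(N, m)).

Local Notation s := (@bw R nu N).
Local Notation shat := (@bw_hat R nu N).

Definition amat : 'M[R]_(N, m) := g *m invmx (g^T *m g).

Definition Gmat : 'M[R]_N := amat *m g^T.

Definition Z_unnormalized (z : 'M[R]_(nu, m)) : R :=
  \prod_(l < N) \sum_(j < N)
    expR (- (2 * shat ^+ 2)^-1
          * enorm ((shat / s) *: col j eta
                   - \sum_(a < m) g l a *: col a z) ^+ 2).

Definition Z_const : R := (fine (integral_mx Z_unnormalized))^-1.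

Definition Z_pdf (z : 'M[R]_(nu, m)) : R := Z_const * Z_unnormalized z.

(* The multi-indices [j : {ffun 'I_N -> 'I_N}] enumerate {1..N}^N. *)
Definition eta_at (j : {ffun 'I_N -> 'I_N}) : 'M[R]_(nu, N) :=
  \matrix_(k, l) eta k (j l).

Definition Md (j : {ffun 'I_N -> 'I_N}) : 'M[R]_N :=
  (eta_at j)^T *m eta_at j.

Definition aj (j : {ffun 'I_N -> 'I_N}) : R := frob (1%:M - Gmat) (Md j).

Definition gammaj (j : {ffun 'I_N -> 'I_N}) : R :=
  expR (- (2 * s ^+ 2)^-1 * aj j).

Definition pj (j : {ffun 'I_N -> 'I_N}) : R :=
  gammaj j * (\sum_(j' : {ffun 'I_N -> 'I_N}) gammaj j')^-1.

Definition Cmat : 'M[R]_m := shat ^+ 2 *: invmx (g^T *m g).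

Definition eta_hat (j : {ffun 'I_N -> 'I_N}) (k : 'I_nu) : 'cV[R]_N :=
  (row k (eta_at j))^T.

Definition zmean (j : {ffun 'I_N -> 'I_N}) (k : 'I_nu) : 'cV[R]_m :=
  (shat / s) *: (amat^T *m eta_hat j k).

Definition Zk_pdf (j : {ffun 'I_N -> 'I_N}) (k : 'I_nu) : 'cV[R]_m -> R :=
  gaussian_pdf Cmat (zmean j k).

End Mixture.

(* Main.v *)
Require Import Defs.
From mathcomp Require Import all_boot all_order all_algebra.
From mathcomp Require Import all_classical all_reals all_analysis.
From mathcomp Require Import measurable_realfun ring.

(** The density of [Z_m] is a product over [l] of sums over [j]; expanding the
    product gives a sum over the multi-indices [j] of [N^N] terms, each of them
    the exponential of minus the squared distance, in matrix space, from
    [(shat / s) eta(j)] to [z g^T], divided by [2 shat^2]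
    ([Z_unnormalized_mixture]).

    Row by row this is a least-squares problem: for a vector [h] of [R^N],
    [|h - g z|^2] splits into the residual [<(I - G) h, h>], which does not
    depend on [z], and the quadratic form of [g^T g] at [z - a^T h]
    ([least_squares]), because the residual [(I - G) h] is orthogonal to the
    columns of [g].  The residuals, summed over the rows, make the weight
    [gamma_j]; the quadratic forms make the Gaussians of covariance
    [C = shat^2 (g^T g)^-1].  The same identity shows that [a_j] is a sum of
    squared norms, hence nonnegative; when [m = N] the matrix [g] is invertible
    and [G = I], so that all weights are equal.

    The Gram matrix [g^T g] is positive definite because the columns of [g] are
    multiples of the eigenvectors [psi^alpha], orthonormal for the inner product
    of [b], by the factors [lambda_alpha ^ kappa]; and these do not vanish, as
    [lambda_alpha = <K psi^alpha, psi^alpha> > 0] ([dm_lambda_gt0]).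

    It remains to know that a Gaussian density integrates to one over [R^m], and
    a product of such densities over the rows to one over the matrices.  The
    integral is an iterated one, so the inner integrals have to be evaluated
    in closed form for every value of the outer variables.  Splitting off the
    first coordinate by the Schur complement [S] of the remaining block [D] of
    the precision matrix, the inner integral is again Gaussian with precision
    [D], and what it leaves is a one-dimensional Gaussian of precision [S];
    the normalizations agree since [det A = S * det D].  The induction is run
    on finite mixtures of Gaussians sharing one precision matrix
    ([integral_rV_gauss_mixture]), a class stable under this elimination, so
    that sums never have to be exchanged with multiple integrals. *)

Set Implicit Arguments.
Unset Strict Implicit.
Unset Printing Implicit Defensive.

Import Order.TTheory GRing.Theory Num.Theory.

Local Open Scope ring_scope.

(** * Dot products and positive definite matrices *)

Section DotTheory.
Context {R : realType}.
Implicit Types (n : nat).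

Lemma dotE n (x y : 'cV[R]_n) : dot x y = \sum_(i < n) x i 0 * y i 0.
Proof. by rewrite /dot mxE; apply: eq_bigr => i _; rewrite mxE. Qed.

Lemma dotC n (x y : 'cV[R]_n) : dot x y = dot y x.
Proof. by rewrite !dotE; apply: eq_bigr => i _; rewrite mulrC. Qed.

Lemma dotDl n (x y z : 'cV[R]_n) : dot (x + y) z = dot x z + dot y z.
Proof. by rewrite /dot linearD mulmxDl mxE. Qed.

Lemma dotDr n (x y z : 'cV[R]_n) : dot x (y + z) = dot x y + dot x z.
Proof. by rewrite /dot mulmxDr mxE. Qed.

Lemma dot0r n (x : 'cV[R]_n) : dot x 0 = 0.
Proof. by rewrite /dot mulmx0 mxE. Qed.

Lemma dotZl n (a : R) (x y : 'cV[R]_n) : dot (a *: x) y = a * dot x y.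
Proof. by rewrite /dot linearZ -scalemxAl mxE. Qed.

Lemma dotZr n (a : R) (x y : 'cV[R]_n) : dot x (a *: y) = a * dot x y.
Proof. by rewrite dotC dotZl dotC. Qed.

Lemma dotBl n (x y z : 'cV[R]_n) : dot (x - y) z = dot x z - dot y z.
Proof. by rewrite dotDl -scaleN1r dotZl mulN1r. Qed.

Lemma dotBr n (x y z : 'cV[R]_n) : dot x (y - z) = dot x y - dot x z.
Proof. by rewrite dotC dotBl 2![dot _ x]dotC. Qed.

Lemma dot_ge0 n (x : 'cV[R]_n) : 0 <= dot x x.
Proof. by rewrite dotE sumr_ge0 // => i _; rewrite -expr2 sqr_ge0. Qed.

Lemma dot_sub_sqr n (x y : 'cV[R]_n) :
  dot (x - y) (x - y) = dot x x - 2 * dot x y + dot y y.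
Proof. by rewrite dotBr !dotBl (dotC y x); ring. Qed.

Lemma dot_eq0 n (x : 'cV[R]_n) : (dot x x == 0) = (x == 0).
Proof.
apply/eqP/eqP => [|->]; last by rewrite dotE big1 // => i _; rewrite !mxE mulr0.
rewrite dotE => /eqP; rewrite psumr_eq0 => [/allP x0|i _]; last first.
  by rewrite -expr2 sqr_ge0.
apply/colP => i; rewrite mxE; apply/eqP.
by have := x0 i (mem_index_enum _); rewrite mulf_eq0 orbb.
Qed.

Lemma enorm_sqr n (x : 'cV[R]_n) : enorm x ^+ 2 = dot x x.
Proof. by rewrite sqr_sqrtr // dot_ge0. Qed.

Lemma dot_mulmxl n p (A : 'M[R]_(n, p)) x y : dot (A *m x) y = dot x (A^T *m y).
Proof. by rewrite /dot trmx_mul mulmxA. Qed.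

Lemma dot_mulmxr n p (A : 'M[R]_(n, p)) x y : dot x (A *m y) = dot (A^T *m x) y.
Proof. by rewrite dot_mulmxl trmxK. Qed.

Lemma dot_col_mx n p (x x' : 'cV[R]_n) (y y' : 'cV[R]_p) :
  dot (col_mx x y) (col_mx x' y') = dot x x' + dot y y'.
Proof. by rewrite /dot tr_col_mx mul_row_col mxE. Qed.

Lemma trmx_mul_dot n (x y : 'cV[R]_n) : x^T *m y = (dot x y)%:M.
Proof. exact: mx11_scalar. Qed.

Lemma dot_scalar (x y : R) : dot x%:M y%:M = x * y.
Proof. by rewrite dotE big_ord1 !mxE !mulr1n. Qed.

(** The cyclicity of the trace turns the Frobenius product with a Gram matrix
    into a sum of quadratic forms over the rows of [B]. *)
Lemma frob_sum_dot n p (A : 'M[R]_n) (B : 'M[R]_(p, n)) :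
  frob A (B^T *m B) = \sum_(k < p) dot (A *m (row k B)^T) (row k B)^T.
Proof.
rewrite /frob mulmxA mxtrace_mulC mulmxA; apply: eq_bigr => k _.
rewrite /dot trmx_mul trmxK -row_mul !mxE.
by apply: eq_bigr => i _; rewrite !mxE.
Qed.

Lemma posdef_unitmx n (A : 'M[R]_n) : posdef A -> A \in unitmx.
Proof.
move=> [_ A0]; rewrite -row_free_unit -kermx_eq0.
apply/eqP/row_matrixP => i; rewrite row0; apply: trmx_inj; rewrite trmx0.
apply/eqP/negPn/negP => /A0; rewrite dotC dot_mulmxr -trmx_mul -row_mul.
by rewrite mulmx_ker row0 trmx0 /dot trmx0 mul0mx mxE ltxx.
Qed.

Lemma posdef_inv n (A : 'M[R]_n) : posdef A -> posdef (invmx A).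
Proof.
move=> Apos; have Au := posdef_unitmx Apos; have [At A0] := Apos.
split=> [|x x0]; first by rewrite trmx_inv At.
rewrite -{2}[x](mulKVmx Au) dotC; apply: A0; apply: contraNN x0 => /eqP x0.
by rewrite -[x](mulKVmx Au) x0 mulmx0.
Qed.

Lemma posdef_scale n (A : 'M[R]_n) (a : R) :
  0 < a -> posdef A -> posdef (a *: A).
Proof.
move=> a0 [At A0]; split=> [|x /A0 x0]; first by rewrite linearZ /= At.
by rewrite -scalemxAl dotZl mulr_gt0.
Qed.

Lemma gram_posdef n p (g : 'M[R]_(n, p)) :
  (forall x : 'cV_p, g *m x = 0 -> x = 0) -> posdef (g^T *m g).
Proof.
move=> g_inj; split=> [|x x0]; first by rewrite trmx_mul trmxK.
rewrite -mulmxA dot_mulmxl trmxK lt_def dot_ge0 dot_eq0 andbT.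
by apply: contraNN x0 => /eqP /g_inj ->.
Qed.

(** * Schur complement of the first coordinate *)

Section Schur.
Variables (n : nat) (a : R) (b : 'cV[R]_n) (D : 'M[R]_n).
Let A : 'M[R]_(1 + n) := block_mx a%:M b^T b D.
(** When [D] is positive definite, [- x *: w] minimizes the quadratic form of
    [A] on the slice where the first coordinate is [x], with minimum
    [S * x ^+ 2]. *)
Let w := invmx D *m b.
Let S := a - dot b w.

(** Completing the square in the last [n] coordinates: for a fixed first
    coordinate, the form of [A] is a translate of the form of [D] plus a
    constant. *)
Lemma schur_quad (x : R) (y : 'cV[R]_n) : D^T = D -> D \in unitmx ->
  dot (A *m col_mx x%:M y) (col_mx x%:M y) =
  S * x ^+ 2 + dot (D *m (y + x *: w)) (y + x *: w).
Proof.
move=> Dt Du; have Dw : D *m w = b by rewrite mulKVmx.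
rewrite mul_block_col dot_col_mx trmx_mul_dot -scalar_mxM -raddfD dot_scalar /=.
rewrite mul_mx_scalar dotDl dotZl mulmxDr -scalemxAr Dw.
rewrite !(dotDl, dotDr, dotZl, dotZr) (dot_mulmxl D y w) Dt Dw /S.
by rewrite (dotC y b); ring.
Qed.

Lemma schur_posdef : posdef A -> posdef D /\ 0 < S.
Proof.
move=> [At A0].
have Dpos : posdef D.
  split=> [|y y0].
    by move: At; rewrite /A tr_block_mx => /eq_block_mx [].
  have := A0 (col_mx 0 y); rewrite mul_block_col dot_col_mx.
  rewrite !mulmx0 !add0r dot0r add0r; apply.
  by rewrite -col_mx0; apply: contraNN y0 => /eqP /eq_col_mx [_ ->].
(* [S] is the value of the form at the minimizer of the slice [x = 1]. *)
split=> //; have := A0 (col_mx 1%:M (- w)).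
rewrite schur_quad ?posdef_unitmx //; last by case: Dpos.
rewrite scale1r addNr mulmx0 dot0r addr0 expr1n mulr1; apply.
rewrite -col_mx0; apply/eqP => /eq_col_mx [/matrixP /(_ 0 0)].
by rewrite !mxE => /eqP; rewrite oner_eq0.
Qed.

Lemma schur_det : D \in unitmx -> \det A = S * \det D.
Proof.
(* The unipotent [L] clears the first column below its top entry. *)
move=> Du; pose L : 'M[R]_(1 + n) := block_mx 1%:M 0 (- w) 1%:M.
have -> : \det A = \det (A *m L) by rewrite det_mulmx det_lblock !det1 !mulr1.
rewrite mulmx_block !mulmx1 !mulmx0 !add0r mulmxN mulmxN mulKVmx // subrr.
rewrite det_ublock; congr (_ * _).
by rewrite det_mx11 trmx_mul_dot -raddfB mxE mulr1n.
Qed.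

End Schur.

Lemma sym_block_mx n (A : 'M[R]_(1 + n)) : A^T = A ->
  A = block_mx (A 0 0)%:M (dlsubmx A)^T (dlsubmx A) (drsubmx A).
Proof.
move=> At; rewrite -[LHS]submxK trmx_dlsub At; congr block_mx.
by rewrite [LHS]mx11_scalar !mxE; congr (A _ _)%:M; apply: val_inj.
Qed.

Lemma posdef_det_gt0 n (A : 'M[R]_n) : posdef A -> 0 < \det A.
Proof.
elim: n A => [|n IH] A Apos; first by rewrite det_mx00.
have AE := sym_block_mx (proj1 Apos); rewrite AE in Apos *.
have [Dpos S0] := schur_posdef Apos.
by rewrite schur_det ?posdef_unitmx // mulr_gt0 // IH.
Qed.

End DotTheory.

(** * Gaussian integrals *)

Section GaussianIntegrals.
Context {R : realType}.
Local Notation leb := (@lebesgue_measure R).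

(** Each term is a constant multiple of a normal density of standard deviation
    [1 / sqrt sigma]. *)
Lemma integral_gauss_mixture1 (I : finType) (c mu : I -> R) (sigma : R) :
  0 < sigma -> (forall i, 0 <= c i) ->
  (\int[leb]_x (\sum_i c i * expR (- 2^-1 * (sigma * (x - mu i) ^+ 2)))%:E =
   ((\sum_i c i) * Num.sqrt (2 * pi / sigma))%:E)%E.
Proof.
move=> sigma0 c0; pose s := (Num.sqrt sigma)^-1.
have s0 : s != 0 by rewrite invr_eq0 sqrtr_eq0 -ltNge.
have s2 : s ^+ 2 = sigma^-1 by rewrite exprVn sqr_sqrtr // ltW.
set K := Num.sqrt _.
have KE : K = (normal_peak s)^-1.
  by rewrite invrK s2 /K; congr Num.sqrt; ring.
have peak0 := normal_peak_gt0 s0.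
pose f i (x : R) : \bar R := ((c i * K)%:E * (normal_pdf (mu i) s x)%:E)%E.
have mpdf i : measurable_fun [set: R] (fun x => (normal_pdf (mu i) s x)%:E).
  by apply/measurable_EFinP; exact: measurable_normal_pdf.
have cK0 i : 0 <= c i * K by rewrite mulr_ge0 ?sqrtr_ge0.
transitivity (\int[leb]_x (\sum_i f i x))%E.
  apply: eq_integral => x _; rewrite -sumEFin; apply: eq_bigr => i _.
  rewrite /f -EFinM; congr (_%:E).
  have -> : normal_pdf (mu i) s x = normal_peak s * normal_fun (mu i) s x.
    by rewrite normal_pdfE.
  rewrite -mulrA KE mulKf ?gt_eqF //.
  by congr (_ * expR _); rewrite s2 -mulr_natl; field; exact: lt0r_neq0.
rewrite ge0_integral_sum //; last 2 first.
- by move=> i; apply: measurable_funeM; exact: mpdf.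
- by move=> i x _; rewrite /f -EFinM lee_fin mulr_ge0 // normal_pdf_ge0.
rewrite mulr_suml -sumEFin; apply: eq_bigr => i _.
rewrite /f ge0_integralZl_EFin //.
- by rewrite integral_normal_pdf // mule1.
- by move=> x _; rewrite lee_fin normal_pdf_ge0.
- exact: mpdf.
Qed.

Lemma eq_integral_rV n (f g : 'rV[R]_n -> \bar R) :
  f =1 g -> integral_rV f = integral_rV g.
Proof. by move=> fg; congr integral_rV; exact/funext. Qed.

Lemma tr_row_mx_sub n (x : R) (v : 'rV[R]_n) (y : 'cV[R]_(1 + n)) :
  (row_mx x%:M v)^T - y = col_mx (x - y 0 0)%:M (v^T - dsubmx y).
Proof.
rewrite tr_row_mx tr_scalar_mx -[in LHS](vsubmxK y) opp_col_mx add_col_mx.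
congr (col_mx _ _); rewrite raddfB /=; congr (_ - _).
by rewrite [LHS]mx11_scalar !mxE; congr (y _ _)%:M; apply: val_inj.
Qed.

(** The normalization of the multivariate Gaussian.  The means and the weights
    are arbitrary: integrating out the last [n] coordinates changes both, as
    the weights then depend on the first coordinate [x] through the Schur
    complement and the means are shifted by a multiple of [x - mu i 0 0]. *)
Lemma integral_rV_gauss_mixture n (I : finType) (A : 'M[R]_n) (c : I -> R)
    (mu : I -> 'cV[R]_n) : posdef A -> (forall i, 0 <= c i) ->
  integral_rV (fun v : 'rV[R]_n => (\sum_i c i *
    expR (- 2^-1 * dot (A *m (v^T - mu i)) (v^T - mu i)))%:E) =
  ((\sum_i c i) * Num.sqrt ((2 * pi) ^+ n / \det A))%:E.
Proof.
elim: n => [|n IH] in A c mu *.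
  move=> _ _ /=; rewrite det_mx00 invr1 mulr1 sqrtr1 mulr1; congr (_%:E).
  by apply: eq_bigr => i _; rewrite dotE big_ord0 mulr0 expR0 mulr1.
move=> Apos c0; have AE := sym_block_mx (proj1 Apos).
set a := A 0 0 in AE; set b := @dlsubmx _ 1 n 1 n A in AE.
set D := @drsubmx _ 1 n 1 n A in AE.
have [Dpos S0] : posdef D /\ 0 < a - dot b (invmx D *m b).
  by apply: schur_posdef; rewrite -AE.
have Du := posdef_unitmx Dpos.
set w := invmx D *m b in S0; set S := a - _ in S0.
have detA : \det A = S * \det D by rewrite AE schur_det.
have detD0 := posdef_det_gt0 Dpos.
set K := Num.sqrt ((2 * pi) ^+ n / \det D).
rewrite /=; transitivity (\int[leb]_x
    (\sum_i (c i * K) * expR (- 2^-1 * (S * (x - mu i 0 0) ^+ 2)))%:E)%E.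
  apply: eq_integral => x _.
  pose c' i := c i * expR (- 2^-1 * (S * (x - mu i 0 0) ^+ 2)).
  pose mu' i : 'cV[R]_n := @dsubmx _ 1 n 1 (mu i) - (x - mu i 0 0) *: w.
  transitivity (integral_rV (fun v : 'rV[R]_n => (\sum_i c' i *
      expR (- 2^-1 * dot (D *m (v^T - mu' i)) (v^T - mu' i)))%:E)).
    apply: eq_integral_rV => v; congr (_%:E); apply: eq_bigr => i _.
    rewrite /c' -mulrA -expRD -mulrDr; congr (_ * expR (_ * _)).
    have -> : (row_mx x%:M v : 'rV[R]_(1 + n))^T - mu i =
              col_mx (x - mu i 0 0)%:M (v^T - @dsubmx _ 1 n 1 (mu i)).
      exact: tr_row_mx_sub.
    rewrite AE schur_quad //; last by case: Dpos.
    by rewrite /mu' opprB addrA addrAC.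
  rewrite IH //; last by move=> i; rewrite mulr_ge0 ?expR_ge0.
  rewrite mulr_suml; congr (_%:E); apply: eq_bigr => i _.
  by rewrite /c' mulrAC.
rewrite integral_gauss_mixture1 //; last first.
  by move=> i; rewrite mulr_ge0 ?sqrtr_ge0.
rewrite -mulr_suml -mulrA; congr ((_ * _)%:E).
rewrite -sqrtrM; last by rewrite divr_ge0 ?exprn_ge0 ?mulr_ge0 ?pi_ge0 // ltW.
congr Num.sqrt; rewrite detA exprS; field.
by rewrite !lt0r_neq0.
Qed.

(** * Integrals over matrices, row by row *)

(** Both sides are the same iterated integral, bracketed differently. *)
Lemma integral_rV_row_mx m n (f : 'rV[R]_(m + n) -> \bar R) :
  integral_rV f =
  integral_rV (fun u : 'rV[R]_m => integral_rV (fun v : 'rV[R]_n =>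
    f (row_mx u v))).
Proof.
elim: m f => [|m IH] f /=.
  apply: (@eq_integral_rV n) => v; congr f; apply/rowP => i.
  by rewrite [RHS]mxE; case: splitP => [[]|] // k ik;
    congr (v _ _); apply: val_inj.
apply: eq_integral => x _; rewrite IH; apply: eq_integral_rV => u.
apply: eq_integral_rV => v; congr f; apply/rowP => i.
(* The index [i] is located in [1 + (m + n)] on the left and in [(1 + m) + n] on
   the right; the bounds exclude the cases where the two locations differ. *)
rewrite mxE; case: splitP => j ij; rewrite [RHS]mxE; case: splitP => k ik;
  have {ij ik} jk := etrans (esym ij) ik.
- rewrite [RHS]mxE; case: splitP => l kl; first by rewrite !ord1.
  by move: (ltn_ord j); rewrite (etrans jk kl) ltnNge.
- by move: (ltn_ord j); rewrite jk ltnNge.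
- rewrite [LHS]mxE [RHS]mxE; case: splitP => l jl; case: splitP => p kp.
  + by have := etrans jk kp; rewrite ord1.
  + by congr (u _ _); apply: val_inj => /=; move: jk; rewrite jl kp => -[].
  + by move: jk; rewrite kp ord1.
  + by move: (ltn_ord k); rewrite -jk jl add1n ltnS ltnNge leq_addr.
- have {}jk : j = (m + k)%N :> nat by case: jk.
  rewrite [LHS]mxE; case: splitP => l jl.
    by move: (ltn_ord l); rewrite -jl jk ltnNge leq_addr.
  by congr (v _ _); apply: val_inj; apply: (@addnI m); rewrite -jl -jk.
Qed.

Lemma index_allpairs_pair (S T : eqType) (s : seq S) (t : seq T) x y :
  uniq s -> x \in s -> y \in t ->
  index (x, y) [seq (x', y') | x' <- s, y' <- t] =
  (index x s * size t + index y t)%N.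
Proof.
elim: s => //= x' s IH /andP[x's us] xs yt; rewrite index_cat size_map.
case: (eqVneq x' x) xs => [<- _|xx'].
  by rewrite map_f // index_map // => ? ? [].
rewrite inE eq_sym (negPf xx') /= => xs; rewrite IH // mulSn addnA.
by case: ifPn => // /mapP[y' _ [xE _]]; rewrite xE eqxx in xx'.
Qed.

(** The flattening of matrices is row-major, which is what makes an integral
    over matrices an iterated integral over their rows. *)
Lemma val_mxvec_index m n (i : 'I_m) (j : 'I_n) :
  mxvec_index i j = (i * n + j)%N :> nat.
Proof.
rewrite /= /enum_rank [enum_rank_in]unlock insubdK; last first.
  rewrite -topredE /= [leqRHS]cardE index_mem mem_enum //.
rewrite enumT unlock /= /prod_enum index_allpairs_pair ?enum_uniq ?mem_enum //.
by rewrite size_enum_ord !index_enum_ord.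
Qed.

Lemma vec_mx_row_mx m n (u : 'rV[R]_m) (v : 'rV[R]_(n * m)) :
  vec_mx (row_mx u v : 'rV[R]_((1 + n) * m)) = col_mx u (vec_mx v).
Proof.
apply/matrixP => i j; rewrite [LHS]mxE [LHS]mxE [RHS]mxE.
case: splitP => k /(etrans (esym (val_mxvec_index i j))) /esym.
all: case: splitP => l il.
- rewrite il ord1 mul0n add0n => kj; congr (u _ _); exact: val_inj.
- rewrite il => kj; move: (ltn_ord k).
  by rewrite kj mulnDl mul1n -addnA ltnNge leq_addr.
- rewrite il ord1 mul0n add0n => kj; move: (ltn_ord j).
  by rewrite -kj ltnNge leq_addr.
- rewrite il mulnDl mul1n -addnA => /addnI kl; rewrite mxE; congr (v _ _).
  by apply: ord_inj; rewrite val_mxvec_index.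
Qed.

Lemma integral_mx_col_mx m n (f : 'M[R]_(1 + n, m) -> R) :
  integral_mx f =
  integral_rV (fun u : 'rV[R]_m =>
    integral_mx (fun z : 'M[R]_(n, m) => f (col_mx u z))).
Proof.
apply: etrans (@integral_rV_row_mx m (n * m) _) _.
apply: eq_integral_rV => u; apply: eq_integral_rV => v.
by rewrite vec_mx_row_mx.
Qed.

Lemma integral_rV_cast m n (e : m = n) (f : 'rV[R]_m -> \bar R) :
  integral_rV f = integral_rV (fun v : 'rV[R]_n => f (castmx (erefl, esym e) v)).
Proof. by case: n / e; apply: eq_integral_rV => v; rewrite castmx_id. Qed.

Lemma integral_cV m (f : 'cV[R]_m -> R) :
  integral_mx f = integral_rV (fun v : 'rV[R]_m => (f v^T)%:E).
Proof.
rewrite /integral_mx (integral_rV_cast (muln1 m)); apply: eq_integral_rV => v.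
congr (f _)%:E; apply/colP => i; rewrite !mxE castmxE ord1; congr (v _ _).
apply: ord_inj; transitivity (nat_of_ord (mxvec_index i (0 : 'I_1))) => //.
by rewrite val_mxvec_index muln1 addn0.
Qed.

(** * Mixtures of normalized Gaussian densities *)

Lemma gaussian_pdf_ge0 m (C : 'M[R]_m) mu z : 0 <= gaussian_pdf C mu z.
Proof. by rewrite mulr_ge0 ?powR_ge0 ?expR_ge0. Qed.

(** The case [A = C^-1] of [integral_rV_gauss_mixture]; its constant
    [sqrt ((2 pi)^m / det C^-1)] cancels the normalization of the density. *)
Lemma gaussian_mixture_integral m (I : finType) (C : 'M[R]_m) (c : I -> R)
    (mu : I -> 'cV[R]_m) : posdef C -> (forall i, 0 <= c i) ->
  integral_rV (fun v : 'rV[R]_m =>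
    (\sum_i c i * gaussian_pdf C (mu i) v^T)%:E) = (\sum_i c i)%:E.
Proof.
move=> Cpos c0; have detC0 := posdef_det_gt0 Cpos.
have V0 : 0 < (2 * pi) ^+ m * \det C.
  by rewrite mulr_gt0 // exprn_gt0 // mulr_gt0 ?pi_gt0.
set k := ((2 * pi) ^+ m * \det C) `^ (- 2^-1).
have k0 : 0 <= k by exact: powR_ge0.
rewrite (eq_integral_rV (g := fun v : 'rV[R]_m => (\sum_i (c i * k) *
    expR (- 2^-1 * dot (invmx C *m (v^T - mu i)) (v^T - mu i)))%:E)); last first.
  by move=> v; congr (_%:E); apply: eq_bigr => i _; rewrite -mulrA.
rewrite integral_rV_gauss_mixture; [|exact: posdef_inv|]; last first.
  by move=> i; rewrite mulr_ge0.
rewrite -mulr_suml det_inv invrK -mulrA /k powRN powR12_sqrt ?ltW //.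
by rewrite mulVf ?mulr1 // sqrtr_eq0 -ltNge.
Qed.

(** A single density is the mixture with one component, indexed by [unit]. *)
Lemma gaussian_pdf_is_pdf m (C : 'M[R]_m) mu :
  posdef C -> is_pdf (gaussian_pdf C mu).
Proof.
move=> Cpos; split=> [z|]; first exact: gaussian_pdf_ge0.
rewrite integral_cV.
have := @gaussian_mixture_integral m unit C (fun=> 1) (fun=> mu) Cpos.
rewrite big_const card_unit /= addr0 => <- //.
apply: eq_integral_rV => v; rewrite big_const card_unit /= addr0.
by rewrite mul1r.
Qed.

(** Induction on the rows: integrating out all rows but the first leaves a
    mixture of Gaussians in the first row. *)
Lemma row_gaussian_mixture_integral n m (I : finType) (C : 'M[R]_m)
    (c : I -> R) (mu : I -> 'I_n -> 'cV[R]_m) :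
  posdef C -> (forall i, 0 <= c i) ->
  integral_mx (fun z : 'M[R]_(n, m) =>
    \sum_i c i * \prod_(k < n) gaussian_pdf C (mu i k) (row k z)^T) =
  (\sum_i c i)%:E.
Proof.
move=> Cpos; elim: n => [|n IH] in c mu * => c0.
  rewrite /integral_mx /=; congr (_%:E); apply: eq_bigr => i _.
  by rewrite big_ord0 mulr1.
rewrite (integral_mx_col_mx (n := n)).
rewrite -(gaussian_mixture_integral (fun i => mu i 0) Cpos c0).
apply: eq_integral_rV => u.
rewrite -(IH (fun i => c i * gaussian_pdf C (mu i 0) u^T)
             (fun i k => mu i (lift 0 k))); last first.
  by move=> i; rewrite mulr_ge0 ?gaussian_pdf_ge0.
congr integral_mx; apply/funext => z; apply: eq_bigr => i _.
rewrite big_ord_recl mulrA; congr (_ * gaussian_pdf _ _ _^T * _).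
  by apply/rowP => j; rewrite !mxE; case: splitP => // l _; rewrite ord1.
apply: eq_bigr => k _; congr (gaussian_pdf _ _ _^T).
by apply/rowP => j; rewrite !mxE; case: splitP => [[[]]|l [/val_inj ->]].
Qed.

End GaussianIntegrals.

(** * The bandwidths are positive *)

Section Bandwidth.
Context {R : realType}.
Variables (nu N : nat).
Hypothesis N0 : (0 < N)%N.

Lemma bw_gt0 : 0 < @bw R nu N.
Proof. by apply: powR_gt0; rewrite divr_gt0 ?mulr_gt0 ?ltr0n ?ltr_wpDl. Qed.

Lemma bw_hat_gt0 : 0 < @bw_hat R nu N.
Proof.
rewrite mulr_gt0 ?bw_gt0 // powR_gt0 // ltr_wpDr ?exprn_gt0 ?bw_gt0 //.
by rewrite divr_ge0 // subr_ge0 ler1n.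
Qed.

End Bandwidth.

(** * Least squares on the columns of g *)

Section LeastSquares.
Context {R : realType}.
Variables (N m : nat) (g : 'M[R]_(N, m)).
Hypothesis gram : posdef (g^T *m g).

Lemma amat_tr : (amat g)^T = invmx (g^T *m g) *m g^T.
Proof. by rewrite trmx_mul trmx_inv trmx_mul trmxK. Qed.

Lemma Gmat_mul (h : 'cV[R]_N) : Gmat g *m h = g *m ((amat g)^T *m h).
Proof. by rewrite amat_tr /Gmat /amat !mulmxA. Qed.

(** Pythagoras: the minimizer is [a^T h] and the residual [(I - G) h] is
    orthogonal to the range of [g]. *)
Lemma least_squares (h : 'cV[R]_N) (z : 'cV[R]_m) :
  dot (h - g *m z) (h - g *m z) =
  dot ((1%:M - Gmat g) *m h) h +
  dot (g^T *m g *m (z - (amat g)^T *m h)) (z - (amat g)^T *m h).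
Proof.
have gu := posdef_unitmx gram.
rewrite mulmxBl mul1mx Gmat_mul; set y := (amat g)^T *m h.
set r := h - g *m y; set d := z - y.
have r0 : g^T *m r = 0.
  by rewrite mulmxBr /y amat_tr (mulmxA g^T g) -(mulmxA _ g^T h) mulKVmx ?subrr.
have -> : h - g *m z = r - g *m d.
  by rewrite /r /d mulmxBr opprB addrA subrK.
have rg x : dot r (g *m x) = 0 by rewrite dot_mulmxr r0 dotC dot0r.
rewrite dot_sub_sqr rg mulr0 subr0 -mulmxA (dot_mulmxl g^T) trmxK.
by rewrite {2}/r dotBr rg subr0.
Qed.

(** The residual form is the squared distance from [h] to the range of [g]. *)
Lemma residual_ge0 (h : 'cV[R]_N) : 0 <= dot ((1%:M - Gmat g) *m h) h.
Proof.
have := least_squares h ((amat g)^T *m h).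
by rewrite subrr dot0r addr0 => <-; apply: dot_ge0.
Qed.

End LeastSquares.

(** [G g = g] for every [g] of full column rank; here [g] can be cancelled. *)
Lemma Gmat_square (R : realType) N (g : 'M[R]_N) :
  posdef (g^T *m g) -> Gmat g = 1%:M.
Proof.
move=> /posdef_unitmx gramu; have gu : g \in unitmx.
  by move: gramu; rewrite unitmx_mul unitmx_tr andbb.
rewrite -[LHS](mulmxK gu) /Gmat /amat -(mulmxA _ g^T g) mulmxKV //.
exact: mulmxV.
Qed.

(** * Expansion of the density as a mixture *)

Section Mixture.
Context {R : realType}.
Variables (nu N m : nat) (eta : 'M[R]_(nu, N)) (g : 'M[R]_(N, m)).
Hypothesis N0 : (0 < N)%N.
Hypothesis gram : posdef (g^T *m g).
Local Notation s := (@bw R nu N).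
Local Notation shat := (@bw_hat R nu N).
Implicit Type j : {ffun 'I_N -> 'I_N}.

Lemma Cmat_posdef : posdef (Cmat nu g).
Proof. by apply: posdef_scale (posdef_inv gram); rewrite exprn_gt0 ?bw_hat_gt0. Qed.

Lemma aj_sum j :
  aj eta g j =
  \sum_(k < nu) dot ((1%:M - Gmat g) *m eta_hat eta j k) (eta_hat eta j k).
Proof. by rewrite /aj /Md frob_sum_dot. Qed.

Lemma aj_ge0 j : 0 <= aj eta g j.
Proof. by rewrite aj_sum sumr_ge0 // => k _; apply: residual_ge0. Qed.

Lemma gammaj_gt0 j : 0 < gammaj eta g j.
Proof. exact: expR_gt0. Qed.

Lemma sum_gammaj_gt0 : 0 < \sum_j gammaj eta g j.
Proof.
rewrite (bigD1 (finfun id)) //= ltr_pwDl ?gammaj_gt0 //.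
by rewrite sumr_ge0 // => j _; rewrite ltW ?gammaj_gt0.
Qed.

Lemma gammaj_lt1 j : (gammaj eta g j < 1) = (0 < aj eta g j).
Proof.
rewrite /gammaj -[X in _ < X]expR0 ltr_expR mulNr oppr_lt0 pmulr_rgt0 //.
by rewrite invr_gt0 mulr_gt0 // exprn_gt0 ?bw_gt0.
Qed.

Lemma gammaj_le1 j : gammaj eta g j <= 1.
Proof.
rewrite /gammaj -[X in _ <= X]expR0 ler_expR mulNr oppr_le0.
by rewrite mulr_ge0 ?aj_ge0 // invr_ge0 mulr_ge0 ?exprn_ge0 // ltW ?bw_gt0.
Qed.

Lemma pj_gt0 j : 0 < pj eta g j.
Proof. by rewrite divr_gt0 ?gammaj_gt0 ?sum_gammaj_gt0. Qed.

Lemma sum_pj : \sum_j pj eta g j = 1.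
Proof. by rewrite -mulr_suml divff // gt_eqF ?sum_gammaj_gt0. Qed.

(** With [N > 1] there is a second multi-index, and it has a positive weight. *)
Lemma pj_lt1 j : (1 < N)%N -> pj eta g j < 1.
Proof.
move=> N1; rewrite -sum_pj (bigD1 j) //= ltrDl.
have [j' j'j] : exists j', j' != j.
  have : (1 < #|{ffun 'I_N -> 'I_N}|)%N.
    by rewrite card_ffun card_ord -[1%N](exp1n N) ltn_exp2r.
  rewrite (cardD1 j) inE /= add1n ltnS => /card_gt0P[j' ].
  by rewrite !inE andbT; exists j'.
rewrite (bigD1 j') //= ltr_pwDl ?pj_gt0 //.
by rewrite sumr_ge0 // => i _; rewrite ltW ?pj_gt0.
Qed.

(** The squared Frobenius norm of [c eta(j) - z g^T], summed by columns on the
    left and by rows on the right. *)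
Lemma sum_enorm_rows (j : {ffun 'I_N -> 'I_N}) (c : R) (z : 'M[R]_(nu, m)) :
  \sum_(l < N) enorm (c *: col (j l) eta - \sum_(a < m) g l a *: col a z) ^+ 2 =
  \sum_(k < nu) dot (c *: eta_hat eta j k - g *m (row k z)^T)
                    (c *: eta_hat eta j k - g *m (row k z)^T).
Proof.
under eq_bigr => l _ do rewrite enorm_sqr dotE.
under [RHS]eq_bigr => k _ do rewrite dotE.
rewrite exchange_big; apply: eq_bigr => k _; apply: eq_bigr => l _.
suff -> : (c *: col (j l) eta - \sum_(a < m) g l a *: col a z) k 0 =
  (c *: eta_hat eta j k - g *m (row k z)^T) l 0 by [].
rewrite !mxE; congr (_ - _); rewrite summxE; apply: eq_bigr => a _.
by rewrite !mxE.
Qed.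

Local Notation gauss_norm := (((2 * pi) ^+ m * \det (Cmat nu g)) `^ (- 2^-1)).

Lemma gauss_norm_gt0 : 0 < gauss_norm.
Proof.
rewrite powR_gt0 // mulr_gt0 ?posdef_det_gt0 //; last exact: Cmat_posdef.
by rewrite exprn_gt0 // mulr_gt0 ?pi_gt0.
Qed.

(** [least_squares] in each row, for the vector [(shat / s) h]: the factor
    [(shat / s)^2 / (2 shat^2) = 1 / (2 s^2)] of the residual is the one of
    [gamma_j], and the factor [1 / shat^2] of the quadratic form turns [g^T g]
    into [C^-1].  The power of the Gaussian normalization is the same for all
    [j]. *)
Lemma Z_component (j : {ffun 'I_N -> 'I_N}) (z : 'M[R]_(nu, m)) :
  \prod_(l < N) expR (- (2 * shat ^+ 2)^-1
     * enorm ((shat / s) *: col (j l) eta - \sum_(a < m) g l a *: col a z) ^+ 2)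
  = gammaj eta g j * (gauss_norm ^+ nu)^-1 *
    \prod_(k < nu) Zk_pdf eta g j k (row k z)^T.
Proof.
have s0 : s != 0 by rewrite gt_eqF ?bw_gt0.
have sh0 : shat != 0 by rewrite gt_eqF ?bw_hat_gt0.
have n0 : gauss_norm != 0 by rewrite gt_eqF ?gauss_norm_gt0.
rewrite /Zk_pdf /gaussian_pdf big_split /= prodr_const card_ord -mulrA.
rewrite mulKf ?expf_neq0 // -!expR_sum -expRD; congr expR.
rewrite -mulr_sumr sum_enorm_rows aj_sum !mulr_sumr -big_split /=.
apply: eq_bigr => k _; rewrite (least_squares gram) -scalemxAr dotZl dotZr.
have -> : invmx (Cmat nu g) = (shat ^+ 2)^-1 *: (g^T *m g).
  rewrite invmxZ ?invmxK // unitmxZ ?unitmx_inv ?posdef_unitmx //.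
  by rewrite unitfE expf_neq0.
rewrite /zmean -scalemxAl dotZl -[(amat g)^T *m (_ *: _)]scalemxAr.
by field; rewrite s0 sh0.
Qed.

Lemma Z_unnormalized_mixture (z : 'M[R]_(nu, m)) :
  Z_unnormalized eta g z =
  \sum_j (gammaj eta g j * (gauss_norm ^+ nu)^-1) *
    \prod_(k < nu) Zk_pdf eta g j k (row k z)^T.
Proof.
rewrite /Z_unnormalized bigA_distr_bigA; apply: eq_bigr => j _.
exact: Z_component.
Qed.

Lemma component_weight_ge0 j : 0 <= gammaj eta g j * (gauss_norm ^+ nu)^-1.
Proof. by rewrite mulr_ge0 ?invr_ge0 ?exprn_ge0 ?powR_ge0 // ltW ?gammaj_gt0. Qed.

(** Every component of the mixture integrates to its weight. *)
Lemma Z_constE :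
  Z_const eta g = gauss_norm ^+ nu / \sum_j gammaj eta g j.
Proof.
rewrite /Z_const (funext Z_unnormalized_mixture).
rewrite (row_gaussian_mixture_integral (zmean eta g) Cmat_posdef component_weight_ge0).
by rewrite /= -mulr_suml invfM invrK mulrC.
Qed.

Lemma Z_pdf_mixture (z : 'M[R]_(nu, m)) :
  Z_pdf eta g z =
  \sum_j pj eta g j * \prod_(k < nu) Zk_pdf eta g j k (row k z)^T.
Proof.
rewrite /Z_pdf Z_constE Z_unnormalized_mixture mulr_sumr; apply: eq_bigr => j _.
rewrite mulrA; congr (_ * _); rewrite /pj; field.
by rewrite expf_neq0 ?gt_eqF ?gauss_norm_gt0 ?sum_gammaj_gt0.
Qed.

Lemma Z_pdf_is_pdf : is_pdf (Z_pdf eta g).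
Proof.
rewrite (funext Z_pdf_mixture).
split=> [z|].
  apply: sumr_ge0 => j _; rewrite mulr_ge0 ?(ltW (pj_gt0 _)) //.
  by apply: prodr_ge0 => k _; exact: gaussian_pdf_ge0.
rewrite (row_gaussian_mixture_integral (zmean eta g) Cmat_posdef) ?sum_pj //.
by move=> j; rewrite ltW ?pj_gt0.
Qed.

End Mixture.

(** * Rank of the diffusion-maps basis *)

Section DiffusionBasis.
Context {R : realType}.
Variables (nu N : nat) (eta : 'M[R]_(nu, N)) (eps : R).
Variables (lambda : 'I_N -> R) (Psi : 'M[R]_N).
Hypothesis K_posdef : posdef (dm_kernel eta eps).
Hypothesis basis : dm_basis eta eps lambda Psi.

Lemma dm_b_unitmx : dm_b eta eps \in unitmx.
Proof.
rewrite unitmxE det_diag unitfE gt_eqF // prodr_gt0 // => i _; rewrite mxE.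
rewrite (bigD1 i) //= ltr_pwDl ?mxE ?expR_gt0 //.
by rewrite sumr_ge0 // => j _; rewrite mxE expR_ge0.
Qed.

(** [P psi = lambda psi] reads [K psi = lambda b psi]; pairing with [psi] gives
    [lambda = <K psi, psi>]. *)
Lemma dm_lambda_gt0 a : 0 < lambda a.
Proof.
have [_ [eig orth _]] := basis.
have KE : dm_kernel eta eps *m col a Psi = lambda a *: (dm_b eta eps *m col a Psi).
  by rewrite scalemxAr -eig /dm_transition -mulmxA mulKVmx // dm_b_unitmx.
have psi0 : col a Psi != 0.
  apply/eqP => psi0; have /eqP := orth a a.
  by rewrite psi0 dot0r eqxx eq_sym oner_eq0.
by have := K_posdef.2 _ psi0; rewrite KE dotZl orth eqxx mulr1.
Qed.

(** If [g x = 0], pairing with [b psi^a] isolates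
    [lambda_a ^ kappa * x_a = 0]. *)
Lemma gmat_inj kappa m (hm : (m <= N)%N) (x : 'cV[R]_m) :
  gmat lambda Psi kappa hm *m x = 0 -> x = 0.
Proof.
have [_ [_ orth _]] := basis => gx; apply/colP => a; rewrite mxE.
pose w := widen_ord hm a.
have gxE : gmat lambda Psi kappa hm *m x =
    \sum_b (lambda (widen_ord hm b) ^+ kappa * x b 0) *: col (widen_ord hm b) Psi.
  apply/colP => l; rewrite mxE summxE; apply: eq_bigr => b _.
  by rewrite !mxE mulrAC.
have : dot (dm_b eta eps *m col w Psi) (gmat lambda Psi kappa hm *m x) = 0.
  by rewrite gx dot0r.
have dot_sumr (I : finType) (u : 'cV[R]_N) (F : I -> 'cV[R]_N) :
  dot u (\sum_i F i) = \sum_i dot u (F i) by rewrite /dot mulmx_sumr summxE.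
rewrite gxE dot_sumr (bigD1 a) //= big1 => [|b ba]; last first.
  by rewrite dotZr orth -val_eqE /= val_eqE eq_sym (negPf ba) mulr0.
rewrite addr0 dotZr orth eqxx mulr1 => /eqP; rewrite mulf_eq0 expf_eq0.
by rewrite gt_eqF ?dm_lambda_gt0 // andbF /= => /eqP.
Qed.

Lemma gmat_gram kappa m (hm : (m <= N)%N) :
  posdef ((gmat lambda Psi kappa hm)^T *m gmat lambda Psi kappa hm).
Proof. by apply: gram_posdef; exact: gmat_inj. Qed.

End DiffusionBasis.

(** * The mixture representation *)

Theorem proposition2 (R : realType) (nu N : nat)
    (hnu : (1 <= nu)%N) (hN : (nu < N)%N)
    (eta : 'M[R]_(nu, N))
    (eta_mean : \sum_(j < N) col j eta = 0)
    (eta_cov : (N%:R - 1)^-1 *: (eta *m eta^T) = 1%:M)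
    (eps : R) (eps_gt0 : 0 < eps)
    (K_posdef : posdef (dm_kernel eta eps))
    (lambda : 'I_N -> R) (Psi : 'M[R]_N)
    (basis : dm_basis eta eps lambda Psi)
    (kappa m : nat) (hm1 : (1 <= m)%N) (hmN : (m <= N)%N) :
  let g := gmat lambda Psi kappa hmN in
  (* (i) *)
  [/\ 0 < Z_const eta g,
      is_pdf (Z_pdf eta g) &
      forall z : 'M[R]_(nu, m),
        Z_pdf eta g z =
        \sum_(j : {ffun 'I_N -> 'I_N})
          pj eta g j * \prod_(k < nu) Zk_pdf eta g j k (row k z)^T] /\
  [/\ \sum_(j : {ffun 'I_N -> 'I_N}) pj eta g j = 1,
      (forall j : {ffun 'I_N -> 'I_N}, possemidef (Md eta j)),
      (forall (j : {ffun 'I_N -> 'I_N}) (l l' : 'I_N),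
         Md eta j l l' = dot (col (j l) eta) (col (j l') eta)),
      posdef (Cmat nu g) &
      (forall (j : {ffun 'I_N -> 'I_N}) (k : 'I_nu),
         is_pdf (Zk_pdf eta g j k))] /\
  (* (ii) *)
  ((m <= N - 1)%N -> forall j : {ffun 'I_N -> 'I_N},
     [/\ 0 <= aj eta g j,
         0 < gammaj eta g j <= 1,
         (gammaj eta g j < 1) = (0 < aj eta g j) &
         0 < pj eta g j < 1]) /\
  (m = N -> forall j : {ffun 'I_N -> 'I_N},
     [/\ aj eta g j = 0,
         gammaj eta g j = 1 &
         pj eta g j = 1 / N%:R ^+ N]).
Proof.
have N1 : (1 < N)%N by exact: leq_ltn_trans hN.
have N0 : (0 < N)%N by exact: ltnW.
have gram := gmat_gram K_posdef basis kappa hmN.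
move=> g; rewrite -/g in gram.
split; first split; last (split; first split; last split).
- rewrite Z_constE // divr_gt0 ?sum_gammaj_gt0 // exprn_gt0 //.
  exact: gauss_norm_gt0.
- exact: Z_pdf_is_pdf.
- exact: Z_pdf_mixture.
- exact: sum_pj.
- move=> j; split=> [|x]; first by rewrite trmx_mul trmxK.
  by rewrite /Md -mulmxA dot_mulmxl trmxK dot_ge0.
- move=> j l l'; rewrite dotE mxE; apply: eq_bigr => k _.
  by rewrite !mxE.
- exact: Cmat_posdef.
- by move=> j k; apply: gaussian_pdf_is_pdf; exact: Cmat_posdef.
- move=> _ j; split.
  + exact: aj_ge0.
  + by rewrite gammaj_gt0 gammaj_le1.
  + exact: gammaj_lt1.
  + by rewrite pj_gt0 pj_lt1.
- move=> mN; have aj0 j : aj eta g j = 0.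
    move: hmN @g gram; rewrite mN => hNN g gram.
    by rewrite /aj Gmat_square // subrr /frob trmx0 mul0mx mxtrace0.
  have gamma1 j : gammaj eta g j = 1 by rewrite /gammaj aj0 mulr0 expR0.
  move=> j; split=> //; rewrite /pj gamma1; congr (_ * _^-1).
  under eq_bigr do rewrite gamma1.
  by rewrite sumr_const card_ffun card_ord natrX.
Qed.
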